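(* Let $X$ be a finite simplicial complex with $m$ vertices which is not a standard simplex. Then, for all $i\geq 0$ and $0\leq j\leq m$, there exists an isomorphism $$E^2_{m-j-1,\,i}\;\cong\;\ddot{\mathrm{B}}^j_i(X)$$ of bigraded modules between the second page $E^2_{*,*}$ of the augmented Mayer-Vietoris spectral sequence of $X$ associated to the anti-star cover, and the $0$-degree überhomology $\ddot{\mathrm{B}}^*_*(X)$ of $X$.
   Context: Fix a commutative ring $R$ of coefficients; all chains and homology are with coefficients in $R$. Let $V(X)=\{v_1,\dots,v_m\}$ be the vertices of $X$, with a fixed order (the choice is auxiliary). **Überhomology.** A bicolouring on $X$ is a map $\varepsilon\colon V(X)\to\{0,1\}$; put $\ell(\varepsilon)=\sum_j\varepsilon(v_j)$. For a simplex $\sigma$ of dimension $n$ its weight is $w_\varepsilon(\sigma)=n+1-\sum_{v\in V(\sigma)}\varepsilon(v)$, i.e. the number of $0$-coloured vertices of $\sigma$. The simplicial differential $\partial$ on $C_*(X;R)$ is the sum of a part $\partial_h$ preserving $w_\varepsilon$ and a part lowering $w_\varepsilon$ by one. The homology of $(C_*(X;R),\partial_h)$, bigraded by the dimension $i$ of simplices and the weight $k$, is the $\varepsilon$-horizontal homology $\mathrm{H}^h(X,\varepsilon)$. If $\varepsilon,\varepsilon'$ differ only at a vertex $v$, with $\varepsilon(v)=0$ and $\varepsilon'(v)=1$, let $d_{\varepsilon,\varepsilon'}\colon \mathrm{H}^h(X,\varepsilon)\to\mathrm{H}^h(X,\varepsilon')$ be induced by $\sigma\mapsto\sigma$ if $w_\varepsilon(\sigma)=w_{\varepsilon'}(\sigma)$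 and $\sigma\mapsto 0$ otherwise. The über cochain complex is $\ddot{\mathrm C}^j(X)=\bigoplus_{\ell(\varepsilon)=j}\mathrm{H}^h(X,\varepsilon)$ with differential $\ddot d^j=\sum \pm d_{\varepsilon,\varepsilon'}\colon\ddot{\mathrm C}^j(X)\to\ddot{\mathrm C}^{j+1}(X)$, the sign being $(-1)^{\#\{w<v\,:\,\varepsilon(w)=1\}}$ where $v$ is the vertex at which $\varepsilon$ and $\varepsilon'$ differ (any other choice of signs making the squares of the Boolean cube anticommute gives an isomorphic homology). Its homology is the überhomology; $\ddot{\mathrm H}^j_{k,i}(X)$ denotes the part in homological degree $j$, weight $k$ and simplicial dimension $i$. The $0$-degree überhomology is $\ddot{\mathrm B}^j_i(X):=\ddot{\mathrm H}^j_{0,i}(X)$. Equivalently, $\ddot{\mathrm B}^*_i(X)$ is the homology of the complex with $j$-th module $\bigoplus_{S\subseteq V(X),|S|=j}\mathrm H_i(X[S])$, where $X[S]$ is the subcomplex of $X$ induced by $S$ (and $X[\emptyset]=\emptyset$ has zero homology), with differential having components $\pm$ the maps $\mathrm H_i(X[S])\to\mathrm H_i(X[S\cup\{v\}])$ induced by inclusion, for $v\notin S$. **Anti-star cover.** For a vertex $v$, $\mathrm{ast}_X(v)$ is the subcomplex of $X$ induced by $V(X)\setminus\{v\}$. The anti-star cover is $\{U_1,\dots,U_m\}$ with $U_s=\mathrm{ast}_X(v_s)$; since $X$ is not a simplex, these subcomplexes cover $X$. For non-empty $J\subseteq\{1,\dots,m\}$ put $U_J=\bigcap_{s\in J}U_s$.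 **Augmented Mayer-Vietoris spectral sequence.** Consider the double complex $C_{p,q}=\bigoplus_{|J|=p+1}C_q(U_J)$ for $p\ge 0$, $q\geq 0$, and $C_{-1,q}=C_q(X)$. The vertical differential $\delta_v\colon C_{p,q}\to C_{p,q-1}$ is the simplicial differential. The horizontal differential $\delta_h\colon C_{p,q}\to C_{p-1,q}$ is the alternating sum of the maps induced by the inclusions $U_J\subseteq U_{J\setminus\{s\}}$, $s\in J$ (with $U_\emptyset:=X$). The augmented Mayer-Vietoris spectral sequence is the spectral sequence of the total complex (differential $\delta_h+(-1)^p\delta_v$) filtered by $p$. Its first page is $E^1_{p,q}=\bigoplus_{|J|=p+1}\mathrm H_q(U_J)$ for $p\geq 0$ and $E^1_{-1,q}=\mathrm H_q(X)$, with differential of bidegree $(-1,0)$ induced by $\delta_h$; the second page is the homology of the first one. *)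

(* Defs.v *)
From HB Require Import structures.
From mathcomp Require Import all_boot all_order all_algebra.
From mathcomp Require Import boolp.

Set Implicit Arguments.
Unset Strict Implicit.
Unset Printing Implicit Defensive.

Import Order.TTheory GRing.Theory Num.Theory.
Local Open Scope ring_scope.
Local Open Scope quotient_scope.

(* Submodules of a module V are elements of submodClosed V; membership is made
   boolean by excluded middle where necessary. *)
Section Submodules.
Variables (R : pzRingType) (V W : lmodType R).
Implicit Types (A B : submodClosed V) (f : {linear V -> W}).

Section Kernel.
Variable f : {linear V -> W}.
Definition ker_pred : {pred V} := [pred x | f x == 0].
Fact ker_closed : submod_closed ker_pred.
Proof.
split=> [|a x y]; first by rewrite inE linear0.
by rewrite !inE => /eqP fx /eqP fy; rewrite linearP fx fy scaler0 addr0.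
Qed.
HB.instance Definition _ := GRing.isSubmodClosed.Build R V ker_pred ker_closed.
Definition kerS : submodClosed V := ker_pred.
End Kernel.

Section Preimage.
Variables (f : {linear V -> W}) (B : submodClosed W).
Definition preim_pred : {pred V} := [pred x | f x \in B].
Fact preim_closed : submod_closed preim_pred.
Proof.
split=> [|a x y]; first by rewrite inE linear0 rpred0.
by rewrite !inE => fx fy; rewrite linearP rpredD // rpredZ.
Qed.
HB.instance Definition _ :=
  GRing.isSubmodClosed.Build R V preim_pred preim_closed.
Definition preimS : submodClosed V := preim_pred.
End Preimage.

Section Image.
Variables (f : {linear V -> W}) (A : submodClosed V).
Definition im_pred : {pred W} := [pred y | `[< exists2 x, x \in A & f x = y >]].
Fact im_closed : submod_closed im_pred.
Proof.
split=> [|a x y]; rewrite !inE.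
  by apply/asboolP; exists 0; rewrite ?rpred0 ?linear0.
move=> /asboolP[x' Ax <-] /asboolP[y' Ay <-]; apply/asboolP.
by exists (a *: x' + y'); rewrite ?linearP ?rpredD ?rpredZ.
Qed.
HB.instance Definition _ := GRing.isSubmodClosed.Build R W im_pred im_closed.
Definition imS : submodClosed W := im_pred.
End Image.

Section Intersection.
Variables A B : submodClosed V.
Definition cap_pred : {pred V} := [pred x | (x \in A) && (x \in B)].
Fact cap_closed : submod_closed cap_pred.
Proof.
split=> [|a x y]; rewrite !inE ?rpred0 // => /andP[Ax Bx] /andP[Ay By].
by rewrite !rpredD ?rpredZ.
Qed.
HB.instance Definition _ := GRing.isSubmodClosed.Build R V cap_pred cap_closed.
Definition capS : submodClosed V := cap_pred.
End Intersection.

Section Sum.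
Variables A B : submodClosed V.
Definition add_pred : {pred V} :=
  [pred z | `[< exists x y, [/\ x \in A, y \in B & z = x + y] >]].
Fact add_closed : submod_closed add_pred.
Proof.
split=> [|a z1 z2]; rewrite !inE.
  by apply/asboolP; exists 0, 0; rewrite !rpred0 addr0.
move=> /asboolP[x1 [y1 [Ax1 By1 ->]]] /asboolP[x2 [y2 [Ax2 By2 ->]]].
apply/asboolP; exists (a *: x1 + x2), (a *: y1 + y2).
by rewrite !rpredD ?rpredZ // scalerDr addrACA.
Qed.
HB.instance Definition _ := GRing.isSubmodClosed.Build R V add_pred add_closed.
Definition addS : submodClosed V := add_pred.
End Sum.

End Submodules.

Section SubmoduleType.
Variables (R : pzRingType) (V : lmodType R) (A : submodClosed V).
Record sub_mod := SubMod {sub_mod_val :> V; _ : sub_mod_val \in A}.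
HB.instance Definition _ := [isSub for sub_mod_val].
HB.instance Definition _ := [Choice of sub_mod by <:].
HB.instance Definition _ := [SubChoice_isSubLmodule of sub_mod by <:].
End SubmoduleType.

Section Quotient.
Variables (R : pzRingType) (V : lmodType R) (N : submodClosed V).
Definition eqmod : rel V := fun x y => x - y \in N.

Lemma submodN x : x \in N -> - x \in N.
Proof. by rewrite -scaleN1r => Nx; rewrite rpredZ. Qed.

Fact eqmod_refl : reflexive eqmod.
Proof. by move=> x; rewrite /eqmod subrr rpred0. Qed.
Fact eqmod_sym : symmetric eqmod.
Proof.
by move=> x y; apply/idP/idP => /submodN; rewrite opprB.
Qed.
Fact eqmod_trans : transitive eqmod.
Proof.
by move=> y x z Nxy Nyz; rewrite /eqmod -(subrKA y) rpredD.
Qed.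
Canonical eqmod_equiv := EquivRel eqmod eqmod_refl eqmod_sym eqmod_trans.
Canonical eqmod_encModRel := defaultEncModRel eqmod.

Definition quot : Type := {eq_quot eqmod}.
HB.instance Definition _ := Choice.on quot.
HB.instance Definition _ := EqQuotient.on quot.

Lemma quot_eqP (x y : V) : (\pi_quot x = \pi_quot y) <-> (x - y \in N).
Proof. by split=> [/eqmodP//|Nxy]; apply/eqmodP. Qed.

Lemma quot_elim (P : quot -> Prop) : (forall x, P (\pi_quot x)) -> forall x, P x.
Proof. by move=> Ppi x; rewrite -[x]reprK. Qed.

Lemma quot_reprP (x : V) : repr (\pi_quot x) - x \in N.
Proof. by apply/quot_eqP; rewrite reprK. Qed.

Definition quot_zero : quot := \pi_quot 0.
Definition quot_opp (x : quot) : quot := \pi_quot (- repr x).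
Definition quot_add (x y : quot) : quot := \pi_quot (repr x + repr y).
Definition quot_scale (a : R) (x : quot) : quot := \pi_quot (a *: repr x).

Fact quot_oppE x : quot_opp (\pi_quot x) = \pi_quot (- x).
Proof. by apply/quot_eqP; rewrite -opprD submodN ?quot_reprP. Qed.
Fact quot_addE x y : quot_add (\pi_quot x) (\pi_quot y) = \pi_quot (x + y).
Proof. by apply/quot_eqP; rewrite opprD addrACA rpredD ?quot_reprP. Qed.
Fact quot_scaleE a x : quot_scale a (\pi_quot x) = \pi_quot (a *: x).
Proof. by apply/quot_eqP; rewrite -scalerBr rpredZ ?quot_reprP. Qed.

Fact quot_addA : associative quot_add.
Proof.
elim/quot_elim=> x; elim/quot_elim=> y; elim/quot_elim=> z.
by rewrite !quot_addE addrA.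
Qed.
Fact quot_addC : commutative quot_add.
Proof. by elim/quot_elim=> x; elim/quot_elim=> y; rewrite !quot_addE addrC. Qed.
Fact quot_add0 : left_id quot_zero quot_add.
Proof. by elim/quot_elim=> x; rewrite quot_addE add0r. Qed.
Fact quot_addN : left_inverse quot_zero quot_opp quot_add.
Proof. by elim/quot_elim=> x; rewrite quot_oppE quot_addE addNr. Qed.

HB.instance Definition _ :=
  GRing.isZmodule.Build quot quot_addA quot_addC quot_add0 quot_addN.

Fact quot_scaleA a b x : quot_scale a (quot_scale b x) = quot_scale (a * b) x.
Proof. by elim/quot_elim: x => x; rewrite !quot_scaleE scalerA. Qed.
Fact quot_scale1 : left_id 1 quot_scale.
Proof. by elim/quot_elim=> x; rewrite quot_scaleE scale1r. Qed.
Fact quot_scaleDr : right_distributive quot_scale +%R.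
Proof.
move=> a; elim/quot_elim=> x; elim/quot_elim=> y.
by rewrite [_ + _]quot_addE !quot_scaleE [RHS]quot_addE scalerDr.
Qed.
Fact quot_scaleDl x : {morph quot_scale^~ x : a b / a + b}.
Proof.
elim/quot_elim: x => x a b.
by rewrite !quot_scaleE [RHS]quot_addE scalerDl.
Qed.

HB.instance Definition _ := GRing.Zmodule_isLmodule.Build R quot
  quot_scaleA quot_scale1 quot_scaleDr quot_scaleDl.

Definition quot_pi (x : V) : quot := \pi_quot x.
Fact quot_pi_is_linear : linear quot_pi.
Proof.
by move=> a x y; rewrite /quot_pi -quot_addE -quot_scaleE.
Qed.
HB.instance Definition _ :=
  GRing.isLinear.Build R V quot _ quot_pi quot_pi_is_linear.
End Quotient.

(* subquot A B is A / (A :&: B), that is A / B whenever B is contained in A. *)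
Section Subquotient.
Variables (R : pzRingType) (V : lmodType R) (A B : submodClosed V).
Definition subquot : lmodType R :=
  quot (preimS (val : {linear sub_mod A -> V}) B).
Definition subquot_pi : {linear sub_mod A -> subquot} := @quot_pi _ _ _.
Definition subquot_repr (x : subquot) : sub_mod A := repr x.

Lemma subquot_reprK x : subquot_pi (subquot_repr x) = x.
Proof. exact: reprK. Qed.

Lemma subquot_eqP (x y : sub_mod A) :
  subquot_pi x = subquot_pi y <-> val x - val y \in B.
Proof.
by rewrite -raddfB; apply: (quot_eqP (preimS (val : {linear sub_mod A -> V}) B)).
Qed.
End Subquotient.

Section SubquotientMap.
Variables (R : pzRingType) (V W : lmodType R) (f : {linear V -> W}).
Variables (A B : submodClosed V) (A' B' : submodClosed W).
Hypotheses (fA : {homo f : x / x \in A >-> x \in A'})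
           (fB : {homo f : x / x \in B >-> x \in B'}).

Definition subquot_fun (x : subquot A B) : subquot A' B' :=
  subquot_pi A' B' (SubMod (fA (valP (subquot_repr x)))).

Fact subquot_fun_is_linear : linear subquot_fun.
Proof.
move=> a x y; rewrite /subquot_fun -linearP; apply/subquot_eqP.
set u := subquot_repr (a *: x + y).
have : val u - val (a *: subquot_repr x + subquot_repr y) \in B.
  by apply/subquot_eqP; rewrite linearP !subquot_reprK.
by move=> /fB; rewrite linearB /= linearP.
Qed.
Definition subquot_map : {linear subquot A B -> subquot A' B'} :=
  HB.pack subquot_fun (GRing.isLinear.Build R (subquot A B) (subquot A' B') _
    subquot_fun subquot_fun_is_linear).
End SubquotientMap.
Arguments subquot_map {R V W f A B A' B'} fA fB.

Section DirectSum.
Variables (R : pzRingType) (I : finType) (V : I -> lmodType R).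
Definition dsum : Type := {dffun forall i, V i}.
HB.instance Definition _ := Choice.on dsum.
Implicit Types x y z : dsum.

Definition dsum_zero : dsum := finfun (fun i => 0 : V i).
Definition dsum_opp x : dsum := finfun (fun i => - x i).
Definition dsum_add x y : dsum := finfun (fun i => x i + y i).
Definition dsum_scale a x : dsum := finfun (fun i => a *: x i).

Fact dsum_addA : associative dsum_add.
Proof. by move=> x y z; apply/ffunP=> i; rewrite !ffunE addrA. Qed.
Fact dsum_addC : commutative dsum_add.
Proof. by move=> x y; apply/ffunP=> i; rewrite !ffunE addrC. Qed.
Fact dsum_add0 : left_id dsum_zero dsum_add.
Proof. by move=> x; apply/ffunP=> i; rewrite !ffunE add0r. Qed.
Fact dsum_addN : left_inverse dsum_zero dsum_opp dsum_add.
Proof. by move=> x; apply/ffunP=> i; rewrite !ffunE addNr. Qed.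
HB.instance Definition _ :=
  GRing.isZmodule.Build dsum dsum_addA dsum_addC dsum_add0 dsum_addN.

Fact dsum_scaleA a b x : dsum_scale a (dsum_scale b x) = dsum_scale (a * b) x.
Proof. by apply/ffunP=> i; rewrite !ffunE scalerA. Qed.
Fact dsum_scale1 : left_id 1 dsum_scale.
Proof. by move=> x; apply/ffunP=> i; rewrite !ffunE scale1r. Qed.
Fact dsum_scaleDr : right_distributive dsum_scale +%R.
Proof. by move=> a x y; apply/ffunP=> i; rewrite !ffunE scalerDr. Qed.
Fact dsum_scaleDl x : {morph dsum_scale^~ x : a b / a + b}.
Proof. by move=> a b; apply/ffunP=> i; rewrite !ffunE scalerDl. Qed.
HB.instance Definition _ := GRing.Zmodule_isLmodule.Build R dsum
  dsum_scaleA dsum_scale1 dsum_scaleDr dsum_scaleDl.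

Lemma dsum_linE a x y i : (a *: x + y) i = a *: x i + y i.
Proof. by rewrite !ffunE. Qed.

Section Product.
Variable A : forall i, submodClosed (V i).
Definition prod_pred : {pred dsum} := [pred x : dsum | [forall i, x i \in A i]].
Fact prod_closed : submod_closed prod_pred.
Proof.
split=> [|a x y]; rewrite !inE; first by apply/forallP=> i; rewrite ffunE rpred0.
move=> /forallP Ax /forallP Ay; apply/forallP=> i.
rewrite dsum_linE; apply: rpredD; [apply: rpredZ; apply: Ax|apply: Ay].
Qed.
HB.instance Definition _ :=
  GRing.isSubmodClosed.Build R dsum prod_pred prod_closed.
Definition prodS : submodClosed dsum := prod_pred.
End Product.

Section Support.
Variable P : pred I.
Definition supp_pred : {pred dsum} :=
  [pred x : dsum | [forall i, ~~ P i ==> (x i == 0)]].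
Fact supp_closed : submod_closed supp_pred.
Proof.
split=> [|a x y]; rewrite !inE.
  by apply/forall_inP=> i _; rewrite ffunE.
move=> /forall_inP x0 /forall_inP y0; apply/forall_inP=> i Pi.
by rewrite dsum_linE (eqP (x0 i Pi)) (eqP (y0 i Pi)) scaler0 addr0.
Qed.
HB.instance Definition _ :=
  GRing.isSubmodClosed.Build R dsum supp_pred supp_closed.
Definition suppS : submodClosed dsum := supp_pred.
End Support.
End DirectSum.
Arguments prodS {R I V} A.
Arguments suppS {R I V} P.

(* The spectral sequence of the complex T with differential d of degree -1,
   filtered by the submodules capS (F p) (T n):
     Z^r_{p,q} = {x in F_p T_{p+q} | d x in F_{p-r}},
     E^r_{p,q} = Z^r_{p,q} / (Z^{r-1}_{p-1,q+1} + d Z^{r-1}_{p+r-1,q-r+2}). *)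
Section SpectralSequence.
Variables (R : pzRingType) (V : lmodType R) (d : {linear V -> V}).
Variables T F : int -> submodClosed V.
Implicit Types r p q : int.

Definition ss_cycles r p q : submodClosed V :=
  capS (capS (F p) (T (p + q))) (preimS d (F (p - r))).

Definition ss_page r p q : lmodType R :=
  subquot (ss_cycles r p q)
    (addS (ss_cycles (r - 1) (p - 1) (q + 1))
          (imS d (ss_cycles (r - 1) (p + r - 1) (q - r + 2)))).
End SpectralSequence.

Section Complexes.
Variable m : nat.
Implicit Types (v s : 'I_m) (sigma tau S J : {set 'I_m}) (X K : {set {set 'I_m}}).

(* A complex is the set of its (nonempty) simplices; every element of 'I_m is a
   vertex. *)
Definition simplicial_complex X : Prop :=
  [/\ set0 \notin X,
      forall v, [set v] \in X &
      forall sigma tau, sigma \in X -> tau \subset sigma -> tau != set0 ->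
        tau \in X].

Definition standard_simplex X : Prop := [set: 'I_m] \in X.

Definition induced X S : {set {set 'I_m}} := [set sigma in X | sigma \subset S].

Definition antistar X v : {set {set 'I_m}} := induced X (~: [set v]).

Definition antistar_cap X J : {set {set 'I_m}} :=
  if J == set0 then X else \bigcap_(s in J) antistar X s.

Definition below v S : nat := #|[set w in S | (w < v)%N]|.

Section Chains.
Variable R : comPzRingType.

Definition chain : lmodType R := dsum (fun _ : {set 'I_m} => R^o).

(* The coefficient of tau in the boundary of sigma; the boundary of a vertex is
   0 (chains are not augmented). *)
Definition incidence sigma tau : R :=
  if tau == set0 then 0
  else \sum_(v in sigma | sigma :\ v == tau) (-1) ^+ below v sigma.

(* The part of the simplicial differential from sigma to the faces tau such that
   P sigma tau. *)
Definition boundary_part (P : rel {set 'I_m}) (c : chain) : chain :=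
  finfun (fun tau => \sum_(sigma | P sigma tau) incidence sigma tau *: c sigma).

Fact boundary_part_is_linear P : linear (boundary_part P).
Proof.
move=> a x y; apply/ffunP=> tau; rewrite dsum_linE !ffunE scaler_sumr -big_split.
apply: eq_bigr => sigma _; rewrite dsum_linE scalerDr !scalerA.
by congr (_ *: _ + _); rewrite mulrC.
Qed.
HB.instance Definition _ P := GRing.isLinear.Build R chain chain _
  (boundary_part P) (boundary_part_is_linear P).

Definition boundary : {linear chain -> chain} :=
  boundary_part (fun _ _ => true).

Definition chains K (q : int) : submodClosed chain :=
  suppS (fun sigma => (sigma \in K) && (#|sigma|%:Z == q + 1)).

(* Colour 1 is true, colour 0 is false. *)
Definition colouring : Type := {ffun 'I_m -> bool}.
HB.instance Definition _ := Finite.on colouring.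
Implicit Types e : colouring.

Definition colour_length e : nat := \sum_v e v.

Definition weight e sigma : nat := #|[set v in sigma | ~~ e v]|.

Definition hboundary e : {linear chain -> chain} :=
  boundary_part (fun sigma tau => weight e sigma == weight e tau).

Definition wchains X e (k : nat) (i : int) : submodClosed chain :=
  suppS (fun sigma =>
    [&& sigma \in X, #|sigma|%:Z == i + 1 & weight e sigma == k]).

Definition hcycles X e k i : submodClosed chain :=
  capS (wchains X e k i) (kerS (hboundary e)).

Definition hboundaries X e k i : submodClosed chain :=
  imS (hboundary e) (wchains X e k (i + 1)).

Definition hhomology X e k i : lmodType R :=
  subquot (hcycles X e k i) (hboundaries X e k i).

Definition cube_edge e e' v : bool :=
  [&& ~~ e v, e' v & [forall w, (w != v) ==> (e w == e' w)]].

Definition recolour e e' (c : chain) : chain :=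
  finfun (fun sigma => if weight e sigma == weight e' sigma then c sigma else 0).

Fact recolour_is_linear e e' : linear (recolour e e').
Proof.
move=> a x y; apply/ffunP=> sigma; rewrite !dsum_linE !ffunE.
by case: eqP => // _; rewrite scaler0 addr0.
Qed.
HB.instance Definition _ e e' := GRing.isLinear.Build R chain chain _
  (recolour e e') (recolour_is_linear e e').

Lemma suppSP (P : pred {set 'I_m}) (c : chain) :
  reflect (forall sigma, ~~ P sigma -> c sigma = 0) (c \in suppS P).
Proof.
by rewrite inE; apply: (iffP forall_inP) => c0 sigma /c0 /eqP.
Qed.

Lemma recolour_wchains X e e' k i :
  {homo recolour e e' : c / c \in wchains X e k i >-> c \in wchains X e' k i}.
Proof.
move=> c /suppSP c0; apply/suppSP=> sigma; rewrite ffunE.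
by case: (eqVneq (weight e sigma)) => // <-; apply: c0.
Qed.

Lemma weight_edge e e' v sigma : cube_edge e e' v ->
  weight e sigma = (weight e' sigma + (v \in sigma))%N.
Proof.
case/and3P=> ev e'v /forall_inP ee'.
rewrite /weight (cardsD1 v) !inE ev andbT addnC; congr (_ + _)%N.
apply: eq_card => w; rewrite !inE; have [->|wv] := eqVneq w v.
  by rewrite e'v andbF.
by rewrite (eqP (ee' w wv)).
Qed.

Lemma weight_face e v sigma : v \in sigma ->
  weight e sigma = (~~ e v + weight e (sigma :\ v))%N.
Proof.
move=> sv; rewrite /weight (cardsD1 v) !inE sv; congr (_ + _)%N.
by apply: eq_card => w; rewrite !inE andbA.
Qed.

Lemma incidence_neq0 sigma tau :
  incidence sigma tau != 0 -> exists2 v, v \in sigma & sigma :\ v = tau.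
Proof.
rewrite /incidence; case: ifP => [_|_ inz]; first by rewrite eqxx.
have [v /andP[sv /eqP tE]|no_v] := pickP (fun v => (v \in sigma) && (sigma :\ v == tau)).
  by exists v.
by rewrite big_pred0 ?eqxx in inz.
Qed.

Lemma recolour_hboundary e e' v c : cube_edge e e' v ->
  recolour e e' (hboundary e c) = hboundary e' (recolour e e' c).
Proof.
move=> edge; apply/ffunP=> tau; rewrite !ffunE; have [ev _ _] := and3P edge.
have wE sigma : (weight e sigma == weight e' sigma) = (v \notin sigma).
  rewrite (weight_edge _ edge) -[X in _ == X]addn0 eqn_add2l.
  by case: (v \in sigma).
rewrite wE; have [vt|vt] /= := boolP (v \in tau).
  rewrite big1 // => sigma _; rewrite ffunE wE.
  have [->|/incidence_neq0[u su tE]] := eqVneq (incidence sigma tau) 0.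
    by rewrite scale0r.
  by move: vt; rewrite -tE !inE => /andP[_ ->]; rewrite scaler0.
rewrite big_mkcond [RHS]big_mkcond; apply: eq_bigr => sigma _; rewrite ffunE wE.
have [->|/incidence_neq0[u su tE]] := eqVneq (incidence sigma tau) 0.
  by rewrite !scale0r !if_same.
have [vs|vs] := boolP (v \in sigma).
  have uv : u = v.
    by apply: contraNeq vt => uv; rewrite -tE !inE vs eq_sym uv.
  by rewrite scaler0 if_same (weight_face e su) tE uv ev -[X in _ == X]add0n eqn_add2r.
by rewrite !(weight_edge _ edge) (negPf vs) (negPf vt) !addn0.
Qed.

Section EdgeMap.
Variables (X : {set {set 'I_m}}) (e e' : colouring) (k : nat) (i : int).
Variables (v : 'I_m) (edge : cube_edge e e' v).

Fact recolour_hcycles : {homo recolour e e' :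
  c / c \in hcycles X e k i >-> c \in hcycles X e' k i}.
Proof.
move=> c /andP[cX]; rewrite !inE => /eqP c0; apply/andP; split.
  exact: recolour_wchains.
by rewrite -(recolour_hboundary _ edge) c0 linear0.
Qed.

Fact recolour_hboundaries : {homo recolour e e' :
  c / c \in hboundaries X e k i >-> c \in hboundaries X e' k i}.
Proof.
move=> c; rewrite !inE => /asboolP[b bX <-]; apply/asboolP.
exists (recolour e e' b); first exact: recolour_wchains.
by rewrite -(recolour_hboundary _ edge).
Qed.

Definition edge_map : {linear hhomology X e k i -> hhomology X e' k i} :=
  subquot_map recolour_hcycles recolour_hboundaries.
End EdgeMap.

Section Uber.
Variables (X : {set {set 'I_m}}) (k : nat) (i : int).

Definition uber_chain : lmodType R := dsum (fun e : colouring => hhomology X e k i).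

Definition uber_chains (j : int) : submodClosed uber_chain :=
  suppS (fun e => (colour_length e)%:Z == j).

Definition edge_sign e v : R := (-1) ^+ #|[set w | e w & (w < v)%N]|.

(* The sum over v has at most one term; it carries the proof that e and e'
   form an edge of the Boolean cube. *)
Definition uber_diff (x : uber_chain) : uber_chain :=
  finfun (fun e' =>
    \sum_e \sum_(v : {v | cube_edge e e' v})
      edge_sign e (val v) *: edge_map X k i (valP v) (x e)).

Fact uber_diff_is_linear : linear uber_diff.
Proof.
move=> a x y; apply/ffunP=> e'; rewrite dsum_linE !ffunE scaler_sumr -big_split.
apply: eq_bigr => e _ /=; rewrite scaler_sumr -big_split; apply: eq_bigr => v _.
rewrite dsum_linE subquot_fun_is_linear; last first.
  exact: (recolour_hboundaries (valP v)).
by rewrite scalerDr !scalerA mulrC.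
Qed.
HB.instance Definition _ := GRing.isLinear.Build R uber_chain uber_chain _
  uber_diff uber_diff_is_linear.

Definition uberhomology (j : int) : lmodType R :=
  subquot (capS (uber_chains j) (kerS uber_diff))
          (imS uber_diff (uber_chains (j - 1))).
End Uber.

Definition uberhomology0 X (j i : int) : lmodType R := uberhomology X 0 i j.

(* C_{p,q} is the set of families x with x J in C_q(U_J) when |J| = p+1 and
   x J = 0 otherwise, for U_J = antistar_cap X J; the column p = -1 is J = set0.
   mv_total n is the direct sum of the C_{p,q} with p + q = n. *)
Section MayerVietoris.
Variable X : {set {set 'I_m}}.

Definition mv_chain : lmodType R := dsum (fun _ : {set 'I_m} => chain).
Implicit Types x : mv_chain.

Definition mv_column J : int := #|J|%:Z - 1.

Definition mv_total (n : int) : submodClosed mv_chain :=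
  prodS (fun J => chains (antistar_cap X J) (n - mv_column J)).

Definition mv_filtration (p : int) : submodClosed mv_chain :=
  suppS (fun J => mv_column J <= p).

Definition mv_horizontal x : mv_chain :=
  finfun (fun J => \sum_(s | s \notin J) (-1) ^+ below s (s |: J) *: x (s |: J)).

Definition mv_vertical x : mv_chain := finfun (fun J => boundary (x J)).

Fact mv_horizontal_is_linear : linear mv_horizontal.
Proof.
move=> a x y; apply/ffunP=> J; rewrite dsum_linE /mv_horizontal.
rewrite [LHS]ffunE [X in _ = a *: X + _]ffunE [X in _ = _ + X]ffunE.
rewrite scaler_sumr -big_split; apply: eq_bigr => s _.
by rewrite dsum_linE scalerDr !scalerA mulrC.
Qed.
HB.instance Definition _ := GRing.isLinear.Build R mv_chain mv_chain _
  mv_horizontal mv_horizontal_is_linear.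

Fact mv_vertical_is_linear : linear mv_vertical.
Proof.
move=> a x y; apply/ffunP=> J; rewrite dsum_linE /mv_vertical.
rewrite [LHS]ffunE [X in _ = a *: X + _]ffunE [X in _ = _ + X]ffunE.
by rewrite dsum_linE linearP.
Qed.
HB.instance Definition _ := GRing.isLinear.Build R mv_chain mv_chain _
  mv_vertical mv_vertical_is_linear.

(* In column p = |J| - 1 the sign (-1)^p is written (-1)^{|J|+1}, which also
   covers p = -1 with an exponent in nat. *)
Definition mv_diff x : mv_chain :=
  finfun (fun J => mv_horizontal x J + (-1) ^+ #|J|.+1 *: mv_vertical x J).

Fact mv_diff_is_linear : linear mv_diff.
Proof.
move=> a x y; apply/ffunP=> J; rewrite dsum_linE /mv_diff.
rewrite [LHS]ffunE [X in _ = a *: X + _]ffunE [X in _ = _ + X]ffunE.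
rewrite !linearP !dsum_linE !scalerDr !scalerA addrACA.
by rewrite [a * _]mulrC.
Qed.
HB.instance Definition _ := GRing.isLinear.Build R mv_chain mv_chain _
  mv_diff mv_diff_is_linear.

Definition mv_page (r p q : int) : lmodType R :=
  ss_page mv_diff mv_total mv_filtration r p q.
End MayerVietoris.

End Chains.
End Complexes.

(* Main.v *)
Require Import Defs.
From HB Require Import structures.
From mathcomp Require Import all_boot all_order all_algebra.
From mathcomp Require Import boolp zify.

Import Order.TTheory GRing.Theory Num.Theory.
Local Open Scope ring_scope.

(** The intersection of the anti-stars indexed by J is the subcomplex induced by
    the complement S of J, so the first page of the spectral sequence and the
    weight 0 part of the über complex have the same modules H_i(X[S]), with
    |J| = p + 1 and |S| = m - p - 1.  Both differentials are induced by the
    inclusions of X[S] in X[S + v]; their signs count the elements smaller than v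
    of J and of S respectively, hence differ by (-1)^v, and multiplying the
    component S by (-1)^(sum of S) matches them.  On the second page, an element
    of Z^2_{p,i} is sent to the class of its component in column p.  *)

(** * Classes in subquotients, computed on representatives *)

Section SubquotientClass.
Context {R : pzRingType} {V : lmodType R}.
Implicit Types A B : submodClosed V.

Lemma capSP A B x : reflect (x \in A /\ x \in B) (x \in capS A B).
Proof. by rewrite inE; apply: andP. Qed.

Lemma addSP A B z :
  reflect (exists x y, [/\ x \in A, y \in B & z = x + y]) (z \in addS A B).
Proof. by rewrite inE; apply: asboolP. Qed.

Lemma imSP (W : lmodType R) (f : {linear V -> W}) A y :
  reflect (exists2 x, x \in A & f x = y) (y \in imS f A).
Proof. by rewrite inE; apply: asboolP. Qed.

Lemma kerSP (W : lmodType R) (f : {linear V -> W}) x :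
  reflect (f x = 0) (x \in kerS f).
Proof. by rewrite inE; apply: eqP. Qed.

Lemma preimSP (W : lmodType R) (f : {linear V -> W}) (B : submodClosed W) x :
  (x \in preimS f B) = (f x \in B).
Proof. by rewrite inE. Qed.

(* The class of c when c is in A; the junk value is 0. *)
Definition subquot_class A B (c : V) : subquot A B :=
  if insub c is Some u then subquot_pi A B u else 0.

Lemma subquot_class_val A B (u : sub_mod A) :
  subquot_class A B (val u) = subquot_pi A B u.
Proof. by rewrite /subquot_class valK. Qed.

Lemma subquot_class_linear A B a c c' : c \in A -> c' \in A ->
  subquot_class A B (a *: c + c') =
  a *: subquot_class A B c + subquot_class A B c'.
Proof.
move=> cA c'A; pose u := SubMod cA; pose u' := SubMod c'A.
by rewrite -[c]/(val u) -[c']/(val u') -linearP !subquot_class_val linearP.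
Qed.

Lemma subquot_class0 A B : subquot_class A B 0 = 0.
Proof. by rewrite -[0]/(val (0 : sub_mod A)) subquot_class_val linear0. Qed.

Lemma subquot_classZ A B a c : c \in A ->
  subquot_class A B (a *: c) = a *: subquot_class A B c.
Proof.
by move=> cA; rewrite -[a *: c]addr0 subquot_class_linear ?rpred0 // subquot_class0 addr0.
Qed.

Lemma subquot_class_sum A B (I : finType) (P : pred I) (F : I -> V) :
  (forall k, P k -> F k \in A) ->
  subquot_class A B (\sum_(k | P k) F k) =
  \sum_(k | P k) subquot_class A B (F k).
Proof.
(* [subquot_class] is additive only on [A], so the induction carries membership in [A] along with
   the value. *)
move=> FA; pose K (x : V) y := x \in A /\ subquot_class A B x = y.
suff [] : K (\sum_(k | P k) F k) (\sum_(k | P k) subquot_class A B (F k)) by [].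
apply: (big_ind2 K) => [|x1 x2 y1 y2 [A1 <-] [A2 <-]|k /FA //].
  by split; [exact: rpred0|exact: subquot_class0].
split; first exact: rpredD.
by rewrite -[x1]scale1r subquot_class_linear // !scale1r.
Qed.

Lemma subquot_class_eq0 A B c : c \in A ->
  subquot_class A B c = 0 <-> c \in B.
Proof.
move=> cA; rewrite -[c]/(val (SubMod cA)) subquot_class_val.
by rewrite -(linear0 (subquot_pi A B)) subquot_eqP /= subr0.
Qed.

Lemma subquot_class_surj A B (x : subquot A B) :
  exists2 c, c \in A & subquot_class A B c = x.
Proof.
exists (val (subquot_repr x)); first exact: (valP (subquot_repr x)).
by rewrite subquot_class_val subquot_reprK.
Qed.

End SubquotientClass.

(** * Maps between subquotients *)

Section SubquotientMaps.
Context {R : pzRingType} {V W : lmodType R}.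
Variables (A B : submodClosed V) (A' B' : submodClosed W).

(** [subquot_map] is computed on the chosen representative; any other one differs from it by an
    element of [B], which [f] sends into [B']. *)
Lemma subquot_map_class (f : {linear V -> W}) 
    (fA : {homo f : x / x \in A >-> x \in A'})
    (fB : {homo f : x / x \in B >-> x \in B'}) c : c \in A ->
  subquot_map fA fB (subquot_class A B c) = subquot_class A' B' (f c).
Proof.
move=> cA; rewrite -[c]/(val (SubMod cA)) subquot_class_val.
rewrite -[f _]/(val (SubMod (fA _ cA))) subquot_class_val.
apply/subquot_eqP; rewrite /= -linearB; apply: fB.
by have /subquot_eqP := subquot_reprK (subquot_pi A B (SubMod cA)).
Qed.

(** [phi] is a plain function, linear on [A] only, because the map from page cycles to über classes
    is linear only there. The equivalence between [B] and [B'] gives both well-definedness and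
    injectivity. *)
Lemma subquot_iso (phi : V -> W) :
    (forall a x y, x \in A -> y \in A -> phi (a *: x + y) = a *: phi x + phi y) ->
    (forall x, x \in A -> phi x \in A') ->
    (forall x, x \in A -> phi x \in B' <-> x \in B) ->
    (forall y, y \in A' -> exists2 x, x \in A & phi x = y) ->
  exists f : {linear subquot A B -> subquot A' B'}, bijective f.
Proof.
move=> phi_lin phiA phiB phi_surj.
pose F (x : subquot A B) : subquot A' B' :=
  subquot_pi A' B' (SubMod (phiA _ (valP (subquot_repr x)))).
have F_lin : linear F.
  move=> a x y; rewrite /F -linearP; apply/subquot_eqP => /=.
  rewrite -phi_lin ?(valP (subquot_repr _)) //.
  (* The difference is put in the form [a *: x + y] with [a = -1], the only shape that [phi_lin]
     covers. *)
  rewrite addrC -scaleN1r -phi_lin ?(valP (subquot_repr _)) //; last first.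
    by rewrite rpredD ?rpredZ ?(valP (subquot_repr _)).
  apply/phiB; first by rewrite !(rpredD, rpredZ) ?(valP (subquot_repr _)).
  rewrite scaleN1r addrC.
  set u := subquot_repr (a *: x + y).
  suff /subquot_eqP : subquot_pi A B u =
      subquot_pi A B (a *: subquot_repr x + subquot_repr y) by [].
  by rewrite linearP !subquot_reprK.
pose f : {linear subquot A B -> subquot A' B'} :=
  HB.pack F (GRing.isLinear.Build R (subquot A B) (subquot A' B') _ F F_lin).
exists f.
have f_inj : injective f.
  apply: raddf_inj => x fx0.
  have : F x = subquot_pi A' B' 0 by rewrite linear0.
  rewrite /F => /subquot_eqP.
  rewrite /= subr0.
  move=> /(phiB _ (valP (subquot_repr x))) xB.
  rewrite -[x]subquot_reprK -(linear0 (subquot_pi A B)).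
  by apply/subquot_eqP; rewrite subr0.
have /boolp.choice[g fK] : forall y, exists x, f x = y.
  move=> y; have [x xA xy] := phi_surj _ (valP (subquot_repr y)).
  exists (subquot_pi A B (SubMod xA)).
  rewrite -[RHS]subquot_reprK; apply/subquot_eqP => /=.
  rewrite -xy addrC -scaleN1r -phi_lin ?(valP (subquot_repr _)) //.
  apply/phiB; first by rewrite !(rpredD, rpredZ) ?(valP (subquot_repr _)).
  rewrite scaleN1r addrC.
  by have /subquot_eqP := subquot_reprK (subquot_pi A B (SubMod xA)).
by exists g => // x; apply: f_inj; rewrite fK.
Qed.
End SubquotientMaps.

(** * Counting the smaller vertices in complementary sets *)

Section Signs.
Context {m : nat}.
Implicit Types (v s t : 'I_m) (J : {set 'I_m}).

Lemma below_setU1 v s J : s \notin J -> below v (s |: J) = ((s < v) + below v J)%N.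
Proof.
move=> sJ; rewrite /below (cardsD1 s) !inE eqxx /=; congr (_ + _)%N.
apply: eq_card => w; rewrite !inE; have [->|//] := eqVneq w s.
by rewrite (negPf sJ).
Qed.

(** Each [w < v] lies in exactly one of [P] and [J], and there are [v] of them. Membership of [v]
    itself is left free, since only strictly smaller vertices are counted. *)
Lemma below_complement v (P : pred 'I_m) J :
  (forall w, w != v -> (w \in J) = ~~ P w) ->
  (#|[set w | P w & (w < v)%N]| + below v J)%N = v.
Proof.
move=> JP; have {2}<- : #|[set w : 'I_m | (w < v)%N]| = v :> nat.
  rewrite -sum1_card (eq_bigl (fun w : 'I_m => (w < v)%N)) => [|w]; last by rewrite inE.
  by rewrite (big_ord_narrow (ltnW (ltn_ord v))) sum1_card card_ord.
rewrite /below -(cardsID [set w | P w] [set w : 'I_m | (w < v)%N]).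
congr (_ + _)%N; apply: eq_card => w; rewrite !inE; first by rewrite andbC.
have [wv|//] := boolP (w < v)%N; last by rewrite !andbF.
by rewrite !andbT JP // -val_eqE neq_ltn wv.
Qed.
End Signs.

(** * The double complex of the anti-star cover *)

Section Chains.
Context {R : comPzRingType} {m : nat} (X : {set {set 'I_m}}).
Hypothesis hX : simplicial_complex X.
Implicit Types (J : {set 'I_m}) (e : @colouring m) (c : chain m R).

(** The formula also covers [J = set0], where the convention gives [X]; hence column -1 needs no
    separate treatment later. *)
Lemma antistar_capE J : antistar_cap X J = induced X (~: J).
Proof.
apply/setP=> sigma; rewrite /antistar_cap !inE.
have [->|/set0Pn[s0 s0J]] := eqVneq J set0; first by rewrite setC0 subsetT andbT.
apply/bigcapP/andP => [sigmaP|[sX sJ] s inJ].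
  have := sigmaP _ s0J; rewrite inE => /andP[sX _]; split=> //.
  apply/subsetP=> v vs; rewrite inE; apply/negP => vJ.
  have := sigmaP _ vJ; rewrite inE => /andP[_ /subsetP/(_ _ vs)].
  by rewrite !inE eqxx.
rewrite inE sX; apply: subset_trans sJ _.
by rewrite setCS sub1set.
Qed.

Lemma chains_antistarP J q c :
  reflect (forall sigma, ~~ [&& sigma \in X, sigma \subset ~: J & #|sigma|%:Z == q + 1] ->
             c sigma = 0)
          (c \in chains R (antistar_cap X J) q).
Proof.
by apply: (iffP (suppSP _ _)) => c0 sigma; move: (c0 sigma);
  rewrite antistar_capE inE -andbA.
Qed.

Lemma chains_antistarS J s q c :
  c \in chains R (antistar_cap X (s |: J)) q -> c \in chains R (antistar_cap X J) q.
Proof.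
move=> /chains_antistarP c0; apply/chains_antistarP=> sigma sP; apply: c0.
apply: contra sP => /and3P[-> sJ ->]; rewrite andbT /=.
by apply: subset_trans sJ _; rewrite setCS subsetUr.
Qed.

Lemma boundary_chains J q c :
  c \in chains R (antistar_cap X J) (q + 1) ->
  boundary m R c \in chains R (antistar_cap X J) q.
Proof.
move=> /chains_antistarP c0; apply/chains_antistarP=> tau tP; rewrite ffunE.
apply: big1 => sigma _.
have [->|inz] := eqVneq (incidence R sigma tau) 0; first exact: scale0r.
have [v vs tE] := incidence_neq0 inz.
rewrite c0 ?scaler0 //; apply: contra tP => /and3P[sX sJ /eqP sq].
have t_s : tau \subset sigma by rewrite -tE subD1set.
(* Chains are not augmented: the empty face has incidence 0, so closure of [X] under nonempty faces
   suffices. *)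
have t_n0 : tau != set0 by apply: contraNneq inz => ->; rewrite /incidence eqxx.
case: hX => _ _ faceX; rewrite (faceX sigma) // (subset_trans t_s) //=.
by move: sq; rewrite (cardsD1 v) vs tE add1n; move: #|tau| => k; lia.
Qed.

Lemma mv_horizontalE (y : mv_chain m R) J : mv_horizontal y J =
  \sum_(s | s \notin J) (-1) ^+ below s (s |: J) *: y (s |: J).
Proof. by rewrite ffunE. Qed.

Lemma mv_diffE (y : mv_chain m R) J : mv_diff y J =
  mv_horizontal y J + (-1) ^+ #|J|.+1 *: boundary m R (y J).
Proof. by rewrite [LHS]ffunE; congr (_ + _ *: _); rewrite ffunE. Qed.

Lemma eq_mv_horizontal (y z : mv_chain m R) J :
  (forall s, s \notin J -> y (s |: J) = z (s |: J)) ->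
  mv_horizontal y J = mv_horizontal z J.
Proof. by move=> yz; rewrite !mv_horizontalE; apply: eq_bigr => s /yz ->. Qed.

Lemma mv_horizontal_eq0 (y : mv_chain m R) J :
  (forall s, s \notin J -> y (s |: J) = 0) -> mv_horizontal y J = 0.
Proof. by move=> y0; rewrite mv_horizontalE big1 // => s /y0 ->; rewrite scaler0. Qed.

Lemma boundary_mv_horizontal (y : mv_chain m R) J :
  boundary m R (mv_horizontal y J) = mv_horizontal (mv_vertical y) J.
Proof.
rewrite !mv_horizontalE linear_sum; apply: eq_bigr => s _.
by rewrite linearZ ffunE.
Qed.

Lemma mv_horizontal_chains (y : mv_chain m R) J q :
  (forall s, s \notin J -> y (s |: J) \in chains R (antistar_cap X (s |: J)) q) ->
  mv_horizontal y J \in chains R (antistar_cap X J) q.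
Proof.
move=> yC; rewrite mv_horizontalE rpred_sum // => s sJ.
by rewrite rpredZ // (chains_antistarS _ s) ?yC.
Qed.

(** Adding two vertices to [J] in either order gives the same set, and the two terms have opposite
    signs: the larger vertex counts the smaller one only when it is added second. *)
Lemma mv_horizontalK (y : mv_chain m R) J : mv_horizontal (mv_horizontal y) J = 0.
Proof.
pose a s t := ((-1) ^+ below s (s |: J) * (-1) ^+ below t (t |: (s |: J))) *:
  y (t |: (s |: J)).
have aN s t : s \notin J -> t \notin J -> (s < t)%N -> a t s = - a s t.
  move=> sJ tJ st.
  have ts : t != s by rewrite -val_eqE neq_ltn st orbT.
  have sNt : s != t by rewrite eq_sym.
  rewrite /a setUCA -scaleN1r [RHS]scalerA -!exprD -exprS; congr (_ *: _).
  rewrite setUCA !below_setU1 ?inE ?negb_or ?ts ?sNt ?sJ ?tJ // !ltnn st.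
  rewrite [(t < s)%N]ltnNge (ltnW st) add1n.
  by rewrite !add0n addnS 2!exprS !mulN1r opprK addnC.
rewrite mv_horizontalE.
transitivity (\sum_s \sum_(t | [&& s \notin J, t \notin J & s != t]) a s t).
  rewrite big_mkcond; apply: eq_bigr => s _; case: ifPn => sJ; last by rewrite big_pred0.
  rewrite mv_horizontalE scaler_sumr; apply: eq_big => [t|t _]; last by rewrite scalerA.
  by rewrite !inE negb_or andbC eq_sym.
(* The ordered pairs are split by [s < t]; exchanging the sums in the second half pairs each term
   with its opposite. *)
pose Q s t := [&& s \notin J, t \notin J & (s < t)%N].
transitivity (\sum_s \sum_(t | Q s t) a s t + \sum_s \sum_(t | Q t s) a s t).
  rewrite -big_split; apply: eq_bigr => s _ /=.
  rewrite (bigID (fun t : 'I_m => (s < t)%N)) /=; congr (_ + _).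
    apply: eq_bigl => t; rewrite /Q -!andbA; do 2!congr (_ && _).
    by rewrite -val_eqE neq_ltn; case: ltngtP.
  apply: eq_bigl => t; rewrite /Q -!andbA; case: (s \in J) => //=; rewrite ?andbF //.
  by case: (t \in J) => //=; rewrite -val_eqE neq_ltn; case: ltngtP.
rewrite [X in _ + X](exchange_big_dep xpredT) //= -big_split big1 // => s _ /=.
rewrite -big_split big1 // => t /and3P[sJ tJ st] /=.
by rewrite (aN s t) // subrr.
Qed.

Lemma mv_columnU1 s J : s \notin J -> mv_column (s |: J) = mv_column J + 1.
Proof. by rewrite /mv_column cardsU1 => ->; rewrite PoszD; lia. Qed.

(** * Comparison of the first page with the weight 0 über complex *)

Definition cycle_family (i : int) (y : mv_chain m R) : Prop :=
  forall J, y J \in chains R (antistar_cap X J) i /\ boundary m R (y J) = 0.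

Definition boundary_family (i : int) (y : mv_chain m R) : Prop :=
  forall J, exists2 b, b \in chains R (antistar_cap X J) (i + 1) &
    boundary m R b = y J.

(** Dictionary between the two sides: the vertices coloured 0 form the index set [J] of the cover,
    those coloured 1 the set [S]; [ones_off] is the inverse. *)
Definition zeros e : {set 'I_m} := [set v | ~~ e v].

Definition ones_off J : @colouring m := [ffun v => v \notin J].

Lemma zerosK e : ones_off (zeros e) = e.
Proof. by apply/ffunP=> v; rewrite ffunE inE negbK. Qed.

Lemma ones_offK J : zeros (ones_off J) = J.
Proof. by apply/setP=> v; rewrite inE ffunE negbK. Qed.

Lemma card_zeros e : (colour_length e + #|zeros e|)%N = m.
Proof.
rewrite -[RHS]card_ord -(cardC (mem (zeros e))) addnC; congr (_ + _)%N.
rewrite /colour_length -sum1_card [RHS]big_mkcond; apply: eq_bigr => v _.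
by rewrite !inE negbK; case: (e v).
Qed.

Lemma weight_eq0 e (sigma : {set 'I_m}) :
  (weight e sigma == 0%N) = (sigma \subset ~: zeros e).
Proof.
rewrite /weight cards_eq0 -subset0; apply/subsetP/subsetP => sub v.
  by move=> vs; rewrite !inE; apply/negP => ev; have := sub v; rewrite !inE vs ev => /(_ isT).
by rewrite !inE => /andP[/sub]; rewrite !inE => /negP.
Qed.

Lemma wchains0P e q c :
  (c \in wchains R X e 0 q) = (c \in chains R (antistar_cap X (zeros e)) q).
Proof.
apply/suppSP/chains_antistarP => c0 sigma sP; apply: c0; move: sP.
  by rewrite weight_eq0 [X in _ && X]andbC.
by rewrite weight_eq0 [X in _ && X]andbC.
Qed.

(** Passing to a face never raises the weight, so from weight 0 nothing of the boundary is
    discarded. *)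
Lemma hboundary0 e q c :
  c \in wchains R X e 0 q -> hboundary R e c = boundary m R c.
Proof.
move=> /suppSP c0; apply/ffunP=> tau; rewrite !ffunE [LHS]big_mkcond.
apply: eq_bigr => sigma _; have [we|we] := eqVneq (weight e sigma) 0%N; last first.
  by rewrite c0 ?scaler0 ?if_same // (negPf we) !andbF.
have [->|/incidence_neq0[v vs tE]] := eqVneq (incidence R sigma tau) 0.
  by rewrite scale0r if_same.
suff wt : weight e tau = 0%N by rewrite we wt.
move: we; rewrite (weight_face e vs) tE => /eqP.
by rewrite addn_eq0 => /andP[_ /eqP].
Qed.

Lemma hcycles0P e i c : (c \in hcycles R X e 0 i) <->
  c \in chains R (antistar_cap X (zeros e)) i /\ boundary m R c = 0.
Proof.
rewrite -wchains0P; split=> [/capSP[cX /kerSP]|[cX c0]].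
  by rewrite (hboundary0 _ _ _ cX).
by apply/capSP; split=> //; apply/kerSP; rewrite (hboundary0 _ _ _ cX).
Qed.

Lemma hboundaries0P e i c : (c \in hboundaries R X e 0 i) <->
  exists2 b, b \in chains R (antistar_cap X (zeros e)) (i + 1) & boundary m R b = c.
Proof.
split=> [/imSP[b bX <-]|[b bX <-]].
  by exists b; rewrite -?wchains0P // (hboundary0 _ _ _ bX).
rewrite -wchains0P in bX; apply/imSP; exists b => //.
exact: hboundary0 bX.
Qed.

(** A simplex of weight 0 for [e] avoids [v], so its weight is unchanged. In weight 0 the edge maps
    are therefore induced by inclusions. *)
Lemma recolour_id e e' v q c : cube_edge e e' v ->
  c \in wchains R X e 0 q -> recolour e e' c = c.
Proof.
move=> edge /suppSP c0; apply/ffunP=> sigma; rewrite ffunE.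
case: (eqVneq (weight e sigma)) => // ww; rewrite c0 //.
apply: contra ww => /and3P[_ _]; rewrite (weight_edge _ edge).
by rewrite addn_eq0 => /andP[/eqP-> /eqP->].
Qed.

Definition vertex_sign e : R := (-1) ^+ \sum_(v | e v) v.

Lemma vertex_signK e : vertex_sign e * vertex_sign e = 1.
Proof. by rewrite -expr2 sqrr_sign. Qed.

(** Meaningful on cycle families only: on any other family some component is the junk value of
    [subquot_class]. *)
Definition family_class (i : int) (y : mv_chain m R) : uber_chain R X 0 i :=
  finfun (fun e => vertex_sign e *:
    subquot_class (hcycles R X e 0 i) (hboundaries R X e 0 i) (y (zeros e))).

Lemma family_classE i y e : family_class i y e = vertex_sign e *:
    subquot_class (hcycles R X e 0 i) (hboundaries R X e 0 i) (y (zeros e)).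
Proof. by rewrite ffunE. Qed.

Lemma family_class_linear i a y z : cycle_family i y -> cycle_family i z ->
  family_class i (a *: y + z) = a *: family_class i y + family_class i z.
Proof.
move=> yC zC; apply/ffunP=> e; rewrite dsum_linE !family_classE dsum_linE.
rewrite subquot_class_linear; [|by apply/hcycles0P..].
by rewrite scalerDr !scalerA mulrC.
Qed.

Lemma family_class_eq0 i y : cycle_family i y ->
  family_class i y = 0 <-> boundary_family i y.
Proof.
move=> yC; split=> [y0 J|yB].
  have := congr1 (fun u : uber_chain R X 0 i => u (ones_off J)) y0.
  (* [vertex_sign] squares to 1, so multiplying by it again strips it off. *)
  rewrite family_classE [RHS]ffunE => /(congr1 ( *:%R (vertex_sign (ones_off J)))).
  rewrite scalerA vertex_signK scale1r scaler0 subquot_class_eq0; last first.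
    exact/hcycles0P.
  by move/hboundaries0P; rewrite ones_offK.
apply/ffunP=> e; rewrite family_classE [RHS]ffunE.
rewrite (_ : subquot_class _ _ _ = 0) ?scaler0 //.
by apply/subquot_class_eq0; [apply/hcycles0P|apply/hboundaries0P].
Qed.

(** Colourings of length [k] correspond to the single column [m - k - 1]; representatives are chosen
    there and set to 0 in all other columns. *)
Lemma family_class_surj i (k : int) (u : uber_chain R X 0 i) :
  u \in uber_chains R X 0 i k ->
  exists y, [/\ cycle_family i y, forall J, mv_column J != m%:Z - k - 1 -> y J = 0 &
    family_class i y = u].
Proof.
move=> /forall_inP uk.
have /boolp.choice[g gP] : forall J, exists c, 
    [/\ c \in chains R (antistar_cap X J) i, boundary m R c = 0,
       mv_column J != m%:Z - k - 1 -> c = 0 &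
     vertex_sign (ones_off J) *: subquot_class (hcycles R X (ones_off J) 0 i)
     (hboundaries R X (ones_off J) 0 i) c = u (ones_off J)].
  move=> J; have [Jk|Jk] := eqVneq (mv_column J) (m%:Z - k - 1).
    have [c cC cu] := subquot_class_surj _ _ (vertex_sign (ones_off J) *: u (ones_off J)).
    exists c; move: (cC) => /hcycles0P; rewrite ones_offK => -[cJ c0].
    by split=> //; rewrite cu scalerA vertex_signK scale1r.
  (* [u] vanishes at [ones_off J] here, because the length of this colouring is [m - #|J|], which is
     not [k]. *)
  exists 0; split=> //; rewrite ?rpred0 ?linear0 // subquot_class0 scaler0.
  apply/esym/eqP/uk; apply: contra Jk => /eqP <-.
  by have := card_zeros (ones_off J); rewrite /mv_column ones_offK; lia.
exists (finfun g); split=> [J|J Jk|]; rewrite ?ffunE; try by case: (gP J) => // *; auto.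
apply/ffunP=> e; rewrite family_classE ffunE; case: (gP (zeros e)) => _ _ _.
by rewrite zerosK.
Qed.

(** Turning [v] from 0 to 1 removes it from [J], so both sides sum, over the vertices [v] outside
    [zeros e'], the class of [y (v |: zeros e')]. What remains is to compare the signs. *)
Lemma uber_diff_family_class i y : cycle_family i y ->
  uber_diff (family_class i y) = family_class i (mv_horizontal y).
Proof.
move=> yC; apply/ffunP=> e'; rewrite family_classE [LHS]ffunE.
have yH e : y (zeros e) \in hcycles R X e 0 i by apply/hcycles0P.
have yH' v : y (v |: zeros e') \in hcycles R X e' 0 i.
  apply/hcycles0P; have [yJ y0] := yC (v |: zeros e').
  by split=> //; apply: chains_antistarS yJ.
pose T e v := (edge_sign R e v * vertex_sign e) *:
  subquot_class (hcycles R X e' 0 i) (hboundaries R X e' 0 i) (y (zeros e)).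
transitivity (\sum_e \sum_(v | cube_edge e e' v) T e v).
  apply: eq_bigr => e _.
  (* [T e v] does not depend on the proof that [v] is an edge, so the sum over the sigma type
     becomes an ordinary one. *)
  rewrite [RHS](@big_sub _ _ _ _ (fun v => cube_edge e e' v)).
  apply: eq_bigr => v _; rewrite family_classE linearZ scalerA.
  congr (_ *: _); rewrite subquot_map_class //=; rewrite (recolour_id _ _ _ i _ (valP v)) //.
  by have /capSP[] := yH e.
rewrite (exchange_big_dep xpredT) //=.
rewrite mv_horizontalE subquot_class_sum => [|v _]; last first.
  by rewrite rpredZ.
rewrite scaler_sumr [RHS]big_mkcond; apply: eq_bigr => v _; rewrite inE negbK.
case: ifPn => e'v; last first.
  by rewrite big_pred0 // => e; rewrite /cube_edge (negPf e'v) andbF.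
(* The only source of an edge at [v] into [e']. *)
pose e : colouring m := [ffun w => if w == v then false else e' w].
rewrite (big_pred1 e) => [|e1]; last first.
  rewrite /cube_edge e'v; apply/and3P/eqP => [[e1v _ /forall_inP ee']|->].
    apply/ffunP=> w; rewrite ffunE; case: eqVneq => [->|/ee'/eqP //].
    exact: negPf.
  by split; rewrite ?ffunE ?eqxx //; apply/forall_inP=> w /negPf wv; rewrite ffunE wv.
have ze : zeros e = v |: zeros e'.
  by apply/setP=> w; rewrite !inE ffunE; case: eqVneq.
rewrite /T ze subquot_classZ //.
rewrite scalerA; congr (_ *: _).
have vsum : (\sum_(w | e' w) w = v + \sum_(w | e w) w)%N.
  rewrite (bigD1 v) //=; congr (_ + _)%N; apply: eq_bigl => w.
  by rewrite ffunE; case: eqVneq; rewrite ?andbF ?andbT.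
(* Writing [v] as this sum makes [below v] occur twice in the exponent on the right, where it
   cancels modulo 2 and leaves the exponent of [edge_sign]. *)
have sign_v := below_complement v e (v |: zeros e').
rewrite /vertex_sign vsum -sign_v; last first.
  by move=> w wv; rewrite !inE ffunE (negPf wv).
rewrite /edge_sign -!exprD -[LHS]signr_odd -[RHS]signr_odd; congr (_ ^+ _).
rewrite !oddD; do 3!case: (odd _) => //.
Qed.
End Chains.

(** * The second page *)

Section Page.
Context {R : comPzRingType} {m : nat} (X : {set {set 'I_m}}).
Hypothesis hX : simplicial_complex X.
Implicit Types (J : {set 'I_m}) (x y z w : mv_chain m R) (i p q r : int).

Lemma sign_scale_eq0 (V : lmodType R) n (c : V) : (-1) ^+ n *: c = 0 -> c = 0.
Proof. by move=> c0; rewrite -[c](signrZK n) c0 scaler0. Qed.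

Lemma mv_chainD x y J : (x + y) J = x J + y J.
Proof. by rewrite [LHS]ffunE. Qed.

Lemma mv_chainB x y J : (x - y) J = x J - y J.
Proof. by rewrite mv_chainD [(- y) J]ffunE. Qed.

Lemma mv_chainZ a x J : (a *: x) J = a *: x J.
Proof. by rewrite [LHS]ffunE. Qed.

Lemma mv_cyclesP r p q x :
  x \in ss_cycles (@mv_diff m R) (mv_total R X) (mv_filtration m R) r p q <->
  [/\ forall J, p < mv_column J -> x J = 0,
      forall J, x J \in chains R (antistar_cap X J) (p + q - mv_column J) &
      forall J, p - r < mv_column J -> mv_diff x J = 0].
Proof.
rewrite /ss_cycles; split=> [/capSP[/capSP[xF xT]]|[xF xT xd]].
  rewrite preimSP => /forall_inP dF; split=> J.
  - by move=> pJ; apply/eqP; move/forall_inP: xF; apply; rewrite -ltNge.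
  - by have := xT; rewrite inE => /forallP.
  - by move=> pJ; apply/eqP/dF; rewrite -ltNge.
apply/capSP; split; [apply/capSP; split|rewrite preimSP].
- by apply/forall_inP=> J; rewrite -ltNge => /xF ->.
- by rewrite inE; apply/forallP.
- by apply/forall_inP=> J; rewrite -ltNge => /xd /eqP.
Qed.

Definition column p x : mv_chain m R :=
  finfun (fun J => if mv_column J == p then x J else 0).

Lemma columnE p x J : column p x J = if mv_column J == p then x J else 0.
Proof. by rewrite ffunE. Qed.

Lemma column_setU1 p x s J : s \notin J ->
  column p x (s |: J) = if mv_column J == p - 1 then x (s |: J) else 0.
Proof. by move=> sJ; rewrite columnE mv_columnU1 // eq_sym -subr_eq eq_sym. Qed.

Lemma column_linear p a x y : column p (a *: x + y) = a *: column p x + column p y.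
Proof.
apply/ffunP=> J; rewrite dsum_linE !columnE dsum_linE.
by case: ifP; rewrite ?scaler0 ?addr0.
Qed.

(** Since [r > 0], the differential of [x] vanishes in column [p]. Its horizontal part there comes
    from column [p + 1], where [x] is 0, so the vertical part vanishes on its own. *)
Lemma cycle_family_column r p i x : 0 < r ->
  x \in ss_cycles (@mv_diff m R) (mv_total R X) (mv_filtration m R) r p i ->
  cycle_family X i (column p x).
Proof.
move=> r_gt0 /mv_cyclesP[xF xT xd] J; rewrite columnE.
case: ifPn => [/eqP Jp|_]; last by rewrite rpred0 linear0.
split; first by have := xT J; rewrite Jp addrAC subrr add0r.
have := xd J; rewrite mv_diffE mv_horizontal_eq0 => [|s sJ]; last first.
  by apply: xF; rewrite mv_columnU1 // Jp; lia.
by rewrite add0r => /(_ _)/sign_scale_eq0; apply; lia.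
Qed.

Lemma cycle_family_horizontal i y :
  cycle_family X i y -> cycle_family X i (mv_horizontal y).
Proof.
move=> yC J; split; first by apply: mv_horizontal_chains => s _; case: (yC (s |: J)).
rewrite boundary_mv_horizontal mv_horizontal_eq0 // => s _.
by rewrite ffunE; case: (yC (s |: J)).
Qed.

Lemma family_class_eq i y z : cycle_family X i y -> cycle_family X i z ->
  family_class X i y = family_class X i z <-> boundary_family X i (y - z).
Proof.
move=> yC zC; rewrite -family_class_eq0 => [|J]; last first.
  rewrite mv_chainB linearB; case: (yC J) (zC J) => yJ -> [zJ ->].
  by rewrite subrr rpredB.
rewrite addrC -scaleN1r family_class_linear // scaleN1r addrC.
by split=> [->|/eqP]; rewrite ?subrr // subr_eq0 => /eqP.
Qed.

Lemma family_class_uber_chains i (k : int) y :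
  (forall J, mv_column J != m%:Z - k - 1 -> y J = 0) ->
  family_class X i y \in uber_chains R X 0 i k.
Proof.
move=> y0; apply/forall_inP=> e ek; rewrite family_classE y0 ?subquot_class0 ?scaler0 //.
by apply: contra ek; have := card_zeros e; rewrite /mv_column; lia.
Qed.

Lemma mv_diff_chains w n J :
  (forall K, w K \in chains R (antistar_cap X K) (n - mv_column K)) ->
  mv_diff w J \in chains R (antistar_cap X J) (n - 1 - mv_column J).
Proof.
move=> wT; rewrite mv_diffE rpredD ?rpredZ //.
  apply: mv_horizontal_chains => s sJ; have := wT (s |: J).
  by rewrite mv_columnU1 // opprD addrCA addrC addrAC.
by apply: boundary_chains => //; have := wT J; congr (_ \in chains _ _ _); lia.
Qed.

(** In column [p] the total and the horizontal differential of [w] differ by a signed boundary of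
    [w J], which is 0 in homology. Thus total boundaries in the denominator of the page become über
    boundaries. *)
Lemma uber_diff_column p i w :
  w \in ss_cycles (@mv_diff m R) (mv_total R X) (mv_filtration m R) 1 (p + 1) i ->
  cycle_family X i (column p (mv_diff w)) ->
  uber_diff (family_class X i (column (p + 1) w)) =
  family_class X i (column p (mv_diff w)).
Proof.
move=> wZ dwC; have wC := cycle_family_column 1 _ _ _ (ltr01) wZ.
rewrite uber_diff_family_class //; apply/esym/family_class_eq => //.
  exact: cycle_family_horizontal.
move=> J; rewrite mv_chainB columnE; case: eqVneq => [Jp|Jp]; last first.
  exists 0; rewrite ?rpred0 // linear0 mv_horizontal_eq0 ?subr0 // => s sJ.
  by rewrite column_setU1 // addrK (negPf Jp).
exists ((-1) ^+ #|J|.+1 *: w J).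
  case/mv_cyclesP: wZ => _ /(_ J) wT _; rewrite rpredZ //.
  by move: wT; congr (_ \in chains _ _ _); lia.
rewrite linearZ mv_diffE (eq_mv_horizontal (column (p + 1) w) w) => [|s sJ].
  by rewrite addrAC subrr add0r.
by rewrite column_setU1 // Jp addrK eqxx.
Qed.

(** All indices are integers, so the neighbouring degrees [p - 1] and [j - 1] need no case
    distinction at the ends of the complexes. *)
Lemma mv_page2_uberhomology i (j p : int) : p = m%:Z - j - 1 ->
  exists f : {linear mv_page R X 2 p i -> uberhomology0 R X j i}, bijective f.
Proof.
move=> pE.
rewrite /mv_page /ss_page /uberhomology0 /uberhomology.
(* The denominator of the page becomes Z^1_{p-1,i+1} + d Z^1_{p+1,i}. *)
rewrite (_ : 2 - 1 = 1 :> int) // (_ : p + 2 - 1 = p + 1); last by lia.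
rewrite (_ : i - 2 + 2 = i); last by lia.
apply: (subquot_iso _ _ _ _ (fun x => family_class X i (column p x))) => [a x y xZ yZ|x xZ|x xZ|u].
- rewrite column_linear family_class_linear //.
  + exact: (cycle_family_column 2 _ _ _ _ xZ).
  + exact: (cycle_family_column 2 _ _ _ _ yZ).
- have xC := cycle_family_column 2 _ _ _ (ltr0Sn _ _) xZ.
  have [xF xT xd] := (mv_cyclesP _ _ _ _).1 xZ.
  apply/capSP; split.
    by apply: family_class_uber_chains => J; rewrite -pE columnE => /negPf->.
  apply/kerSP; rewrite [LHS]uber_diff_family_class //.
  apply/family_class_eq0; first exact: cycle_family_horizontal.
  move=> J; have [Jp|Jp] := eqVneq (mv_column J) (p - 1); last first.
    exists 0; rewrite ?rpred0 // linear0 mv_horizontal_eq0 // => s sJ.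
    by rewrite column_setU1 // (negPf Jp).
  (* As [r = 2], the differential of [x] also vanishes in column [p - 1], so the horizontal image of
     column [p] is the boundary of this multiple of [x J]. *)
  exists (- (-1) ^+ #|J|.+1 *: x J).
    by rewrite rpredZ //; have := xT J; congr (_ \in chains _ _ _); lia.
  rewrite linearZ (eq_mv_horizontal _ x) => [|s sJ]; last first.
    by rewrite column_setU1 // Jp eqxx.
  have := xd J; rewrite mv_diffE => /(_ _)/eqP; rewrite addr_eq0 => /(_ _)/eqP->; last by lia.
  by rewrite /= scaleNr.
- have xC := cycle_family_column 2 _ _ _ (ltr0Sn _ _) xZ.
  have p1E : p + 1 = m%:Z - (j - 1) - 1 by lia.
  split=> [/imSP[u uj ux]|/addSP[z [_ [zZ /imSP[w wZ <-] xE]]]]; last first.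
    (* [z] lies in filtration [p - 1] and contributes nothing to column [p]. *)
    have xw : column p x = column p (mv_diff w).
      apply/ffunP=> J; rewrite xE !columnE mv_chainD; case: eqVneq => // Jp.
      have [zF _ _] := (mv_cyclesP _ _ _ _).1 zZ.
      by rewrite zF ?add0r // Jp; lia.
    apply/imSP; exists (family_class X i (column (p + 1) w)).
      by apply: family_class_uber_chains => J; rewrite -p1E columnE => /negPf->.
    by rewrite [LHS]uber_diff_column ?xw // -xw.
  (* Conversely, an über preimage comes from a family [y] in column [p + 1], and
     [column p x - mv_horizontal y] is the boundary of some [b]. *)
  have [y [yC yp yu]] := family_class_surj _ _ _ _ uj.
  have hyC := cycle_family_horizontal _ _ yC.
  move: ux; rewrite -yu [LHS]uber_diff_family_class // => /esym.
  move=> /(family_class_eq _ _ _ xC hyC) yB.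
  have {yB}/boolp.choice[b bP] : forall J, exists b,
      b \in chains R (antistar_cap X J) (i + 1) /\
      boundary m R b = column p x J - mv_horizontal y J.
    by move=> J; have [b] := yB J; rewrite mv_chainB; exists b.
  rewrite -p1E in yp; have [xF xT xd] := (mv_cyclesP _ _ _ _).1 xZ.
  (* y corrected in column p, so that mv_diff w agrees with x in columns >= p. *)
  pose w : mv_chain m R :=
    finfun (fun J => if mv_column J == p then (-1) ^+ #|J|.+1 *: b J else y J).
  have wE J : w J = if mv_column J == p then (-1) ^+ #|J|.+1 *: b J else y J.
    by rewrite ffunE.
  have wF J : p + 1 < mv_column J -> w J = 0.
    move=> Jp; rewrite wE yp; [case: eqVneq => //; lia|].
    by rewrite neq_lt Jp orbT.
  have wT J : w J \in chains R (antistar_cap X J) (p + 1 + i - mv_column J).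
    rewrite wE; case: eqVneq => [Jp|Jp].
      rewrite rpredZ //; case: (bP J) => bJ _.
      by move: bJ; congr (_ \in chains _ _ _); lia.
    have [Jp'|/yp->] := eqVneq (mv_column J) (p + 1); last by rewrite rpred0.
    by case: (yC J) => yJ _; move: yJ; congr (_ \in chains _ _ _); lia.
  have wh J : p <= mv_column J -> mv_horizontal w J = mv_horizontal y J.
    move=> Jp; apply: eq_mv_horizontal => s sJ; rewrite wE mv_columnU1 //.
    by case: eqVneq => //; lia.
  have dw J : p <= mv_column J -> mv_diff w J = x J.
    move=> Jp; rewrite mv_diffE wh // wE; case: eqVneq => [Jp'|Jp'].
      by rewrite linearZ (bP J).2 /= signrZK columnE Jp' eqxx addrC subrK.
    rewrite (yC J).2 scaler0 addr0 xF; last by lia.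
    apply: mv_horizontal_eq0 => s sJ; apply: yp.
    by rewrite mv_columnU1 //; apply/negP => /eqP; lia.
  apply/addSP; exists (x - mv_diff w), (mv_diff w); split; last by rewrite subrK.
    apply/mv_cyclesP; split=> J; rewrite ?mv_chainB.
    + by move=> Jp; rewrite dw ?subrr //; lia.
    + have -> : p - 1 + (i + 1) - mv_column J = p + i - mv_column J by lia.
      rewrite rpredB //; have := mv_diff_chains w (p + 1 + i) J wT.
      by congr (_ \in chains _ _ _); lia.
    (* Only column [p - 1] needs work. There [w] is 0, and the boundaries of [x J] and of
       [mv_horizontal w J] both equal [(-1) ^+ #|J| *: mv_horizontal x J]. *)
    + move=> Jp; rewrite mv_diffE mv_horizontal_eq0 => [|s sJ]; last first.
        by rewrite mv_chainB dw ?subrr // mv_columnU1 //; lia.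
      rewrite add0r mv_chainB.
      have [Jp'|Jp'] := leP p (mv_column J).
        by rewrite dw // subrr linear0 scaler0.
      have {Jp Jp'}Jp : mv_column J = p - 1 by lia.
      have wJ : w J = 0.
        rewrite wE yp; first by case: eqVneq => //; lia.
        by apply/negP => /eqP; lia.
      have xh : mv_horizontal x J = - ((-1) ^+ #|J|.+1 *: boundary m R (x J)).
        by apply/eqP; rewrite -addr_eq0 -mv_diffE xd // Jp; lia.
      have -> : mv_diff w J = mv_horizontal w J.
        by rewrite mv_diffE wJ linear0 scaler0 addr0.
      rewrite linearB boundary_mv_horizontal.
      have -> : mv_horizontal (mv_vertical w) J = (-1) ^+ #|J| *: mv_horizontal x J.
        (* By the choice of [b], the boundary of [w] in column [p] is a signed
           [x - mv_horizontal y], and applying [mv_horizontal] again kills the [y] term. The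
           exponent has dropped by 2, from [#|s |: J|.+1] to [#|J|]. *)
        transitivity (mv_horizontal ((-1) ^+ #|J| *: (x - mv_horizontal y)) J).
          apply: eq_mv_horizontal => s sJ; rewrite ffunE wE mv_columnU1 // Jp subrK eqxx.
          rewrite linearZ (bP _).2 /= mv_chainZ mv_chainB columnE mv_columnU1 //.
          by rewrite Jp subrK eqxx cardsU1 sJ add1n 2!exprS !mulN1r opprK.
        rewrite linearZ mv_chainZ linearB mv_chainB mv_horizontalK subr0.
        by [].
      by rewrite xh exprS mulN1r !scaleNr opprK signrZK subrr scaler0 oppr0.
  apply/imSP; exists w => //; apply/mv_cyclesP; split=> // J Jp.
  by rewrite dw ?xF //; lia.
- move=> /capSP[uj /kerSP du].
  have [y [yC yp yu]] := family_class_surj _ _ _ _ uj.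
  have hyC := cycle_family_horizontal _ _ yC.
  move: du; rewrite -yu [LHS]uber_diff_family_class //.
  move=> /(family_class_eq0 _ _ _ hyC) yB.
  have {yB}/boolp.choice[b bP] : forall J, exists b,
      b \in chains R (antistar_cap X J) (i + 1) /\ boundary m R b = mv_horizontal y J.
    by move=> J; have [b] := yB J; exists b.
  rewrite -pE in yp.
  (* An über cycle only makes [mv_horizontal y] a vertical boundary. The added chain in column
     [p - 1] cancels it against the sign of the vertical differential, so that [mv_diff x] vanishes
     from column [p - 1] upwards, as [r = 2] demands. *)
  pose x : mv_chain m R :=
    finfun (fun J => if mv_column J == p - 1 then - (-1) ^+ #|J|.+1 *: b J else y J).
  have xE J : x J = if mv_column J == p - 1 then - (-1) ^+ #|J|.+1 *: b J else y J.
    by rewrite ffunE.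
  have xh J : mv_column J >= p - 1 -> mv_horizontal x J = mv_horizontal y J.
    move=> Jp; apply: eq_mv_horizontal => s sJ; rewrite xE mv_columnU1 //.
    by case: eqVneq => //; lia.
  exists x; last first.
    congr (family_class _ _ _); apply/ffunP=> J; rewrite columnE xE.
    case: eqVneq => [->|/yp->//]; case: eqVneq => //; lia.
  apply/mv_cyclesP; split=> J.
  + move=> Jp; rewrite xE yp; [case: eqVneq => //; lia|].
    by rewrite neq_lt Jp orbT.
  + rewrite xE; case: eqVneq => [Jp|Jp].
      rewrite rpredZ //; case: (bP J) => bJ _.
      by move: bJ; congr (_ \in chains _ _ _); lia.
    have [Jp'|/yp->] := eqVneq (mv_column J) p; last by rewrite rpred0.
    by case: (yC J) => yJ _; move: yJ; congr (_ \in chains _ _ _); lia.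
  + move=> Jp; rewrite mv_diffE xh; last by lia.
    rewrite xE; case: eqVneq => [_|Jp'].
      by rewrite linearZ (bP J).2 /= scaleNr scalerN signrZK subrr.
    rewrite (yC J).2 scaler0 addr0 mv_horizontal_eq0 // => s sJ; apply: yp.
    by rewrite mv_columnU1 //; apply/negP => /eqP; lia.
Qed.
End Page.

Theorem theorem1p1 (R : comPzRingType) (m : nat) (X : {set {set 'I_m}})
    (hX : simplicial_complex X) (hXs : ~ standard_simplex X)
    (i j : nat) (hj : (j <= m)%N) :
  exists f : {linear mv_page R X 2 (m%:Z - j%:Z - 1) i%:Z ->
                     uberhomology0 R X j%:Z i%:Z},
    bijective f.
Proof. by apply: mv_page2_uberhomology. Qed.
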